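(* Let $T>0$, $d,e\in\mathbb{N}^*$, $\alpha,\beta\in\,]0,1]$ with $\alpha+\beta>1$, $F\in \mathrm{C}^{\alpha\text{-H\''ol}}([0,T];\mathcal{P}_{\mathrm{ck}}(M_{e,d}(\mathbb{R})))$, $w\in \mathrm{C}^{\beta\text{-H\''ol}}([0,T];\mathbb{R}^d)$ and $r\geqslant r_{\min}$. Let $(D_n)$ be a sequence of dissections of $[0,T]$, $D_n=(t_0^n,\dots,t_{m_n}^n)$ with $0=t_0^n<\dots<t_{m_n}^n=T$, and assume that the mesh $|D_n|=\max_{0\leqslant i\leqslant m_n-1}(t_{i+1}^n-t_i^n)$ converges to $0$. For each $n$, each $i\in\{0,\dots,m_n-1\}$ and any $t\in[t_i^n,t_{i+1}^n]$, set $$F_n(t)=\frac{t_{i+1}^n-t}{t_{i+1}^n-t_i^n}F(t_i^n)+\frac{t-t_i^n}{t_{i+1}^n-t_i^n}F(t_{i+1}^n).$$ Then $$\lim_{n\to\infty}d_{\mathrm{H}}\bigl(J_{T,\alpha,r}(F_n,w),J_{T,\alpha,r}(F,w)\bigr)=0.$$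
   Context: $M_{e,d}(\mathbb{R})$ is the space of real $e\times d$ matrices, identified with $\mathbb{R}^{ed}$ with Euclidean norm $\|\cdot\|$. For $E=\mathbb{R}^m$, $\mathcal{P}_{\mathrm{ck}}(E)$ is the set of nonempty convex compact subsets of $E$, with Minkowski addition $A+B=\{a+b : a\in A,b\in B\}$ and scalar multiplication $\lambda A=\{\lambda a : a\in A\}$, $\lambda\geqslant0$; $d_{\mathrm{H}}$ is the Hausdorff distance. Demyanov distance: for $C\in\mathcal{P}_{\mathrm{ck}}(E)$ and $l\in E$ let $Y(l,C)=\{c\in C:\langle l,c\rangle=\max_{x\in C}\langle l,x\rangle\}$; if $Y(l,C)$ is a singleton its element is denoted $y(l,C)$ and $l$ is called an exposing direction of $C$; $\mathcal{T}_C$ is the set of exposing directions of $C$. Then $d_{\mathrm{D}}(A,B)=\sup\{\|y(l,A)-y(l,B)\| : l\in\mathcal{T}_A\cap\mathcal{T}_B\}$. Steiner constant: $\mathrm{St}(C)=\frac1{v_m}\int_{\mathcal{T}_C\cap B(0,1)}y(x,C)\,dx$ for $C\in\mathcal{P}_{\mathrm{ck}}(\mathbb{R}^m)$, where $B(0,1)$ is the unit ball of $\mathbb{R}^m$ and $v_m$ its volume. The map $\mathrm{St}:(\mathcal{P}_{\mathrm{ck}}(\mathbb{R}^m),d_{\mathrm{H}})\to\mathbb{R}^m$ is Lipschitz, and $\mathfrak{k}_m$ denotes its sharp (smallest) Lipschitz constant. $\|F\|_{\alpha,T}=\sup_{s<t}d_{\mathrm{H}}(F(s),F(t))/|t-s|^\alpha$;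 $\mathrm{C}^{\alpha\text{-H\''ol}}$ is the set of maps with $\|\cdot\|_{\alpha,T}<\infty$ (same notation for point-valued functions, with the norm distance); $\|F\|_{\alpha,T,\mathrm{Dem}}\in[0,+\infty]$ is defined like $\|F\|_{\alpha,T}$ with $d_{\mathrm{D}}$ instead of $d_{\mathrm{H}}$. $r_{\min}=\min(\mathfrak{k}_{ed}\|F\|_{\alpha,T},\ \|F\|_{\alpha,T,\mathrm{Dem}})$. For $G\in \mathrm{C}^{\alpha\text{-H\''ol}}([0,T];\mathcal{P}_{\mathrm{ck}}(M_{e,d}(\mathbb{R})))$, $\mathcal{S}_{\alpha,r}(G)$ is the set of measurable $g:[0,T]\to M_{e,d}(\mathbb{R})$ with $g(t)\in G(t)$ for all $t$ and $\|g\|_{\alpha,T}\leqslant r$, and $J_{T,\alpha,r}(G,w)=\{\int_0^Tg(t)\,dw(t) : g\in\mathcal{S}_{\alpha,r}(G)\}\subset\mathbb{R}^e$, where $\int_0^Tg\,dw$ is the Young integral (limit of Riemann sums $\sum_kg(t_k)(w(t_{k+1})-w(t_k))$ as the mesh of the dissection of $[0,T]$ tends to $0$). *)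

(* Defs.v *)
From HB Require Import structures.
From mathcomp Require Import all_boot all_order all_algebra.
From mathcomp Require Import all_classical all_reals all_analysis.

Set Implicit Arguments.
Unset Strict Implicit.
Unset Printing Implicit Defensive.

Import Order.TTheory GRing.Theory Num.Theory.
Import numFieldNormedType.Exports.

Local Open Scope classical_set_scope.
Local Open Scope ring_scope.

(* The library norm `|A| on matrices is the max norm; [enorm] is the Euclidean
   norm of 'M_(m, n) seen as R^(m * n).  Both induce the same topology, so the
   library's [compact] and [open] are the right notions. *)
Section euclidean.
Context {R : realType} {m n : nat}.
Implicit Types A B : 'M[R]_(m, n).

Definition mxdot A B : R := \sum_i \sum_j A i j * B i j.

Definition enorm A : R := Num.sqrt (mxdot A A).

Definition edistance A B : \bar R := (enorm (A - B))%:E.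

End euclidean.

Section compact_convex_sets.
Context {R : realType} {m n : nat}.
Local Notation E := 'M[R]_(m, n).
Implicit Types A B C : set E.

Definition convex_compact C : Prop :=
  [/\ C !=set0, compact C & convex_set (C : set (convex_lmodType E))].

Definition minkowski_add A B : set E := [set a + b | a in A & b in B].

Definition minkowski_scale (c : R) A : set E := [set c *: a | a in A].

(* Total and [0, +oo]-valued: +oo if no e >= 0 is admissible (e.g. between an
   empty and a nonempty set), 0 between two empty sets. *)
Definition hausdorff A B : \bar R := ereal_inf
  [set e%:E | e in [set e : R | [/\ 0 <= e,
     forall a, A a -> exists2 b, B b & enorm (a - b) <= e &
     forall b, B b -> exists2 a, A a & enorm (a - b) <= e]]].

Definition exposed_face (l : E) C : set E :=
  [set c | C c /\ forall x, C x -> mxdot l x <= mxdot l c].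

Definition exposing C : set E :=
  [set l | exists c, exposed_face l C = [set c]].

(* y(l, C); meaningful for l in [exposing C] *)
Definition exposed_point (l : E) C : E := xget 0 (exposed_face l C).

Definition demyanov A B : \bar R := ereal_sup
  [set edistance (exposed_point l A) (exposed_point l B)
     | l in exposing A `&` exposing B].

End compact_convex_sets.

Lemma sigma_finite_product d1 d2 (T1 : measurableType d1)
    (T2 : measurableType d2) (R : realType)
    (m1 : {sigma_finite_measure set T1 -> \bar R})
    (m2 : {sigma_finite_measure set T2 -> \bar R}) :
  sigma_finite setT (m1 \x m2)%E.
Proof.
have /sigma_finiteP[F [TF ndF Foo]] := sigma_finiteT m1.
have /sigma_finiteP[G [TG ndG Goo]] := sigma_finiteT m2.
exists (fun n => F n `*` G n).
  rewrite -setXTT TF TG predeqE => -[x y]; split.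
    move=> [/= [n _ Fnx] [k _ Gky]]; exists (maxn n k) => //; split.
    - by move: x Fnx; exact/subsetPset/ndF/leq_maxl.
    - by move: y Gky; exact/subsetPset/ndG/leq_maxr.
  by move=> [n _ []/= ? ?]; split; exists n.
move=> k; have [? ?] := Foo k; have [? ?] := Goo k.
split; first exact: measurableX.
by rewrite product_measure1E// lte_mul_pinfty// ge0_fin_numE.
Qed.

(* Lebesgue measure on R^n, by iterating the product of measures. *)
Section lebesgue_tuple_step.
Context {R : realType} {n : nat}.
Local Notation RT := (measurableTypeR R).
Variable mu : {sigma_finite_measure set (n.-tuple RT) -> \bar R}.

Definition consT (p : RT * n.-tuple RT) : n.+1.-tuple RT := [tuple of p.1 :: p.2].

Let measurable_consT : measurable_fun setT consT.
Proof. exact: measurable_cons. Qed.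

Definition lebesgue_tuple_step : set (n.+1.-tuple RT) -> \bar R :=
  pushforward (@lebesgue_measure R \x mu)%E consT.

Let step0 : lebesgue_tuple_step set0 = 0%E.
Proof. by rewrite /lebesgue_tuple_step /pushforward preimage_set0 measure0. Qed.

Let step_ge0 A : (0 <= lebesgue_tuple_step A)%E.
Proof. exact: measure_ge0. Qed.

Let step_sigma_additive : semi_sigma_additive lebesgue_tuple_step.
Proof.
move=> F mF tF mUF; rewrite /lebesgue_tuple_step /pushforward preimage_bigcup.
apply: measure_semi_sigma_additive.
- by move=> k; rewrite -[X in measurable X]setTI; exact: measurable_consT.
- apply/trivIsetP => /= i j _ _ ij; rewrite -preimage_setI.
  by move/trivIsetP : tF => /(_ _ _ _ _ ij) ->//; rewrite preimage_set0.
- by rewrite -preimage_bigcup -[X in measurable X]setTI; exact: measurable_consT.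
Qed.

HB.instance Definition _ := isMeasure.Build _ _ _
  lebesgue_tuple_step step0 step_ge0 step_sigma_additive.

Let step_sigma_finite : sigma_finite setT lebesgue_tuple_step.
Proof.
have [G GT Goo] := sigma_finite_product (@lebesgue_measure R) mu.
pose uncons (t : n.+1.-tuple RT) : RT * n.-tuple RT :=
  (thead t, [tuple of behead t]).
have unconsK : cancel consT uncons.
  by case=> x t; congr pair; apply/val_inj.
have consTK : cancel uncons consT by move=> t; exact/esym/tuple_eta.
have muncons : measurable_fun setT uncons.
  apply/measurable_fun_pairP; split; first exact: measurable_tnth.
  exact: measurable_behead.
exists (fun k => uncons @^-1` G k).
  by rewrite -preimage_bigcup -GT preimage_setT.
move=> k; have [mG muG] := Goo k; split.
  by rewrite -[X in measurable X]setTI; exact: muncons.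
rewrite /lebesgue_tuple_step /pushforward.
by rewrite (_ : _ @^-1` _ = G k)//; apply/seteqP; split => p /=; rewrite unconsK.
Qed.

HB.instance Definition _ := Measure_isSigmaFinite.Build _ _ _
  lebesgue_tuple_step step_sigma_finite.

End lebesgue_tuple_step.

Section lebesgue_tuple0.
Context {R : realType}.
Local Notation RT := (measurableTypeR R).

Definition lebesgue_tuple0 : set (0.-tuple RT) -> \bar R := \d_[tuple].

HB.instance Definition _ := FiniteMeasure.on lebesgue_tuple0.

End lebesgue_tuple0.

Fixpoint lebesgue_tuple (R : realType) (n : nat) :
    {sigma_finite_measure set (n.-tuple (measurableTypeR R)) -> \bar R} :=
  match n with
  | 0 => lebesgue_tuple0
  | n'.+1 => lebesgue_tuple_step (lebesgue_tuple R n')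
  end.

Section steiner.
Context {R : realType} {m : nat}.
Local Notation RT := (measurableTypeR R).

Definition row_of_tuple (t : m.-tuple RT) : 'rV[R]_m := \row_i tnth t i.

Definition unit_ball : set 'rV[R]_m := [set x | enorm x <= 1].

Definition ball_volume : R :=
  fine (lebesgue_tuple R m (row_of_tuple @^-1` unit_ball)).

Definition steiner (C : set 'rV[R]_m) : 'rV[R]_m :=
  \row_i (ball_volume^-1 *
    \int[lebesgue_tuple R m]_(t in row_of_tuple @^-1` (exposing C `&` unit_ball))
       exposed_point (row_of_tuple t) C ord0 i).

End steiner.

Definition steiner_lip (R : realType) (m : nat) : \bar R := ereal_inf
  [set k%:E | k in [set k : R | 0 <= k /\
     forall A B : set 'rV[R]_m, convex_compact A -> convex_compact B ->
       (edistance (steiner A) (steiner B) <= k%:E * hausdorff A B)%E]].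

Definition holder_norm {R : realType} {X : Type} (dist : X -> X -> \bar R)
    (alpha T : R) (f : R -> X) : \bar R := ereal_sup
  [set x | exists s t, [/\ 0 <= s, s < t, t <= T &
     x = (dist (f s) (f t) * (((t - s) `^ alpha)^-1)%:E)%E]].

Definition holder_fun {R : realType} {m n : nat} (alpha T : R)
    (f : R -> 'M[R]_(m, n)) : Prop :=
  (holder_norm edistance alpha T f < +oo)%E.

Definition holder_multifun {R : realType} {m n : nat} (alpha T : R)
    (F : R -> set 'M[R]_(m, n)) : Prop :=
  (forall t, 0 <= t <= T -> convex_compact (F t)) /\
  (holder_norm hausdorff alpha T F < +oo)%E.

Definition r_min {R : realType} {e d : nat} (alpha T : R)
    (F : R -> set 'M[R]_(e, d)) : \bar R :=
  mine (steiner_lip R (e * d)%N * holder_norm hausdorff alpha T F)%E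
       (holder_norm demyanov alpha T F).

(* As in [itv_partition], a dissection 0 = t_0 < ... < t_m = T is given by
   s = [:: t_1; ...; t_m]; thus m = size s. *)
Definition dissection {R : realType} (T : R) (s : seq R) : Prop :=
  itv_partition 0 T s.

Definition node {R : realType} (s : seq R) (i : nat) : R := nth 0 (0 :: s) i.

Definition mesh {R : realType} (s : seq R) : R :=
  \big[Num.max/0]_(i < size s) (node s i.+1 - node s i).

Section young_integral.
Context {R : realType} {e d : nat}.
Implicit Types (g : R -> 'M[R]_(e, d)) (w : R -> 'cV[R]_d) (T : R).

Definition riemann_sum g w (s : seq R) : 'cV[R]_e :=
  \sum_(i < size s) g (node s i) *m (w (node s i.+1) - w (node s i)).

Definition is_young_integral T g w (I : 'cV[R]_e) : Prop :=
  forall eps : R, 0 < eps -> exists2 delta : R, 0 < delta &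
    forall s, dissection T s -> mesh s < delta ->
      enorm (riemann_sum g w s - I) < eps.

Definition young_integral T g w : 'cV[R]_e :=
  xget 0 [set I | is_young_integral T g w I].

(* Functions on [0, T] are represented by total functions on R, of which only
   the values on [0, T] matter. *)
Definition holder_selections T (alpha r : R) (G : R -> set 'M[R]_(e, d)) :
    set (R -> 'M[R]_(e, d)) :=
  [set g | [/\ measurable_fun (`[0, T] : set (measurableTypeR R))
                 (g : _ -> g_sigma_algebraType (@open 'M[R]_(e, d))),
               forall t, 0 <= t <= T -> G t (g t) &
               (holder_norm edistance alpha T g <= r%:E)%E]].

Definition young_image T (alpha r : R) (G : R -> set 'M[R]_(e, d)) w :
    set 'cV[R]_e :=
  [set young_integral T g w | g in holder_selections T alpha r G].

End young_integral.

(* Main.v *)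
(* The Young integral of a Hoelder function is the limit of Riemann sums with an
   explicit rate C * mesh^(alpha + beta - 1), where C depends only on the Hoelder
   constants (sewing by bisection).  Given a selection g of F, its piecewise linear
   interpolation along D_n is a selection of F_n; it is r-Hoelder with the same r
   by Jensen's inequality for the concave modulus r h^alpha, and it has the same
   Riemann sum along D_n as g, so the two integrals are close uniformly in g.
   Conversely, if infinitely many selections g_n of F_n had integrals far from
   J(F), their pointwise limit along an ultrafilter would be an r-Hoelder selection
   of F (each F(t) is compact), and comparing with Riemann sums along one fixed
   dissection would bring the integrals together.
   Neither direction presupposes that a selection exists: if J(F) is empty then so
   is J(F_n) for large n, and [hausdorff set0 set0 = 0]. *)
Require Import Defs.
From HB Require Import structures.
From mathcomp Require Import all_boot all_order all_algebra.
From mathcomp Require Import all_classical all_reals all_analysis.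
From mathcomp Require Import ring lra.

Import Order.TTheory GRing.Theory Num.Theory.
Import numFieldNormedType.Exports.

Local Open Scope classical_set_scope.
Local Open Scope ring_scope.

(** * Euclidean norm of matrices *)

Section euclidean_norm.
Context {R : realType} {m n : nat}.
Implicit Types (A B C : 'M[R]_(m, n)) (k : R).

Lemma mxdotC A B : mxdot A B = mxdot B A.
Proof. by apply: eq_bigr => i _; apply: eq_bigr => j _; rewrite mulrC. Qed.

Lemma mxdotDl A B C : mxdot (A + B) C = mxdot A C + mxdot B C.
Proof.
rewrite /mxdot -big_split/=; apply: eq_bigr => i _.
by rewrite -big_split/=; apply: eq_bigr => j _; rewrite mxE mulrDl.
Qed.

Lemma mxdotZl k A B : mxdot (k *: A) B = k * mxdot A B.
Proof.
rewrite /mxdot mulr_sumr; apply: eq_bigr => i _.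
by rewrite mulr_sumr; apply: eq_bigr => j _; rewrite mxE mulrA.
Qed.

Lemma mxdotDr A B C : mxdot A (B + C) = mxdot A B + mxdot A C.
Proof. by rewrite mxdotC mxdotDl !(mxdotC _ A). Qed.

Lemma mxdotZr k A B : mxdot A (k *: B) = k * mxdot A B.
Proof. by rewrite mxdotC mxdotZl mxdotC. Qed.

Lemma mxdot_ge0 A : 0 <= mxdot A A.
Proof. by apply: sumr_ge0 => i _; apply: sumr_ge0 => j _; rewrite -expr2 sqr_ge0. Qed.

Lemma enorm_ge0 A : 0 <= enorm A.
Proof. exact: sqrtr_ge0. Qed.

Lemma enorm_sqr A : enorm A ^+ 2 = mxdot A A.
Proof. by rewrite sqr_sqrtr// mxdot_ge0. Qed.

Lemma entry_le_enorm A i j : `|A i j| <= enorm A.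
Proof.
rewrite -ler_sqr ?nnegrE ?enorm_ge0// enorm_sqr real_normK ?num_real//.
rewrite /mxdot (bigD1 i)//= (bigD1 j)//= -expr2 -addrA lerDl addr_ge0//.
  by apply: sumr_ge0 => l _; rewrite -expr2 sqr_ge0.
by apply: sumr_ge0 => l _; apply: sumr_ge0 => l' _; rewrite -expr2 sqr_ge0.
Qed.

Lemma enorm_eq0 A : enorm A = 0 -> A = 0.
Proof.
move=> A0; apply/matrixP => i j; rewrite mxE; apply/eqP.
by rewrite -normr_le0 (le_trans (entry_le_enorm A i j))// A0.
Qed.

Lemma enorm0 : enorm (0 : 'M[R]_(m, n)) = 0.
Proof.
by rewrite /enorm -[X in mxdot X _](scale0r 0) mxdotZl mul0r sqrtr0.
Qed.

Lemma enormZ k A : enorm (k *: A) = `|k| * enorm A.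
Proof.
by rewrite /enorm mxdotZl mxdotZr mulrA -expr2 sqrtrM ?sqr_ge0// sqrtr_sqr.
Qed.

Lemma enormN A : enorm (- A) = enorm A.
Proof. by rewrite -scaleN1r enormZ normrN1 mul1r. Qed.

Lemma enormC A B : enorm (A - B) = enorm (B - A).
Proof. by rewrite -enormN opprB. Qed.

(** Cauchy-Schwarz: the squared norm of [enorm B *: A - enorm A *: B] is nonnegative and equals
    twice [enorm A * enorm B] times the gap between the two sides. Cancelling that product is why
    null norms are treated first. *)
Lemma mxdot_le_enorm A B : mxdot A B <= enorm A * enorm B.
Proof.
have [A0|A0] := eqVneq (enorm A) 0.
  by rewrite A0 mul0r (enorm_eq0 _ A0) -(scale0r 0) mxdotZl mul0r.
have [B0|B0] := eqVneq (enorm B) 0.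
  by rewrite B0 mulr0 mxdotC (enorm_eq0 _ B0) -(scale0r 0) mxdotZl mul0r.
have a0 : 0 < enorm A by rewrite lt_neqAle eq_sym A0 enorm_ge0.
have b0 : 0 < enorm B by rewrite lt_neqAle eq_sym B0 enorm_ge0.
have ab0 : 0 < enorm A * enorm B by rewrite mulr_gt0.
have := mxdot_ge0 (enorm B *: A + (- enorm A) *: B).
rewrite !(mxdotDl, mxdotDr, mxdotZl, mxdotZr) (mxdotC B A) -!enorm_sqr => H.
by rewrite -subr_ge0 -(pmulr_rge0 _ ab0); nra.
Qed.

Lemma enormD A B : enorm (A + B) <= enorm A + enorm B.
Proof.
rewrite -ler_sqr ?nnegrE ?addr_ge0 ?enorm_ge0//.
rewrite enorm_sqr mxdotDl !mxdotDr sqrrD !enorm_sqr (mxdotC B A).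
by have := mxdot_le_enorm A B; lra.
Qed.

Lemma enorm_triangle B A C : enorm (A - C) <= enorm (A - B) + enorm (B - C).
Proof. by rewrite (le_trans _ (enormD _ _))// addrA subrK. Qed.

(** With [enorm_le_normr], this carries limits and completeness between the max norm of the topology
    and the Euclidean norm of the estimates. *)
Lemma normr_le_enorm A : `|A| <= enorm A.
Proof.
rewrite /Num.norm/= mx_normrE; apply/bigmax_leP; split; first exact: enorm_ge0.
by move=> i _; exact: entry_le_enorm.
Qed.

Lemma enorm_le_normr A : enorm A <= Num.sqrt (m * n)%:R * `|A|.
Proof.
rewrite -[`|A| in leRHS]normr_id -sqrtr_sqr -sqrtrM ?ler0n// ler_wsqrtr//.
apply: (@le_trans _ _ (\sum_(i < m) \sum_(j < n) `|A| ^+ 2)).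
  apply: ler_sum => i _; apply: ler_sum => j _.
  rewrite -expr2 -[leLHS]ger0_norm ?sqr_ge0// normrX ler_sqr ?nnegrE//.
  have [|iA] := eqVneq `|A| 0; first by move/normr0_eq0 ->; rewrite mxE normr0.
  rewrite /Num.norm/= mx_normrE.
  by rewrite (le_trans _ (le_bigmax _ _ (i, j))).
by rewrite !sumr_const !card_ord -mulrnA mulnC mulr_natl.
Qed.

End euclidean_norm.

(** Cauchy-Schwarz for each entry of the product, a row of [A] against a column of [B]; the sum of
    the squared bounds then factors. *)
Lemma enorm_mulmx {R : realType} {m n p : nat} (A : 'M[R]_(m, n))
    (B : 'M[R]_(n, p)) : enorm (A *m B) <= enorm A * enorm B.
Proof.
rewrite -ler_sqr ?nnegrE ?mulr_ge0 ?enorm_ge0// exprMn !enorm_sqr.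
have -> : mxdot B B = \sum_j \sum_k B k j * B k j by rewrite /mxdot exchange_big.
rewrite /mxdot mulr_suml; apply: ler_sum => i _.
rewrite mulr_sumr; apply: ler_sum => j _.
pose a := row i A; pose b := (col j B)^T.
have -> : \sum_k A i k * A i k = enorm a ^+ 2.
  by rewrite enorm_sqr /mxdot big_ord1; apply: eq_bigr => k _; rewrite mxE.
have -> : \sum_k B k j * B k j = enorm b ^+ 2.
  by rewrite enorm_sqr /mxdot big_ord1; apply: eq_bigr => k _; rewrite !mxE.
have abE : (A *m B) i j = mxdot a b.
  by rewrite mxE /mxdot big_ord1; apply: eq_bigr => k _; rewrite !mxE.
rewrite abE -expr2 -exprMn -[leLHS]ger0_norm ?sqr_ge0// normrX.
rewrite ler_sqr ?nnegrE ?mulr_ge0 ?enorm_ge0// ler_norml mxdot_le_enorm andbT.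
by rewrite lerNl -[- _]mulN1r -mxdotZl (le_trans (mxdot_le_enorm _ _))// scaleN1r enormN.
Qed.

(** A concave power lies below its tangent at [m]. Homogeneity reduces this to [m = 1], which is
    Young's inequality for the conjugate exponents [a^-1] and [(1 - a)^-1]; the value [a = 1] is
    separate because the second exponent degenerates. *)
Lemma powR_tangent {R : realType} (a m : R) : 0 < a <= 1 -> 0 < m ->
  forall x, 0 <= x -> x `^ a <= a * m `^ a / m * x + (1 - a) * m `^ a.
Proof.
move=> /andP[a0 a1] m0 x x0.
have young y : 0 <= y -> y `^ a <= a * y + (1 - a).
  move=> y0; have [->|/eqP a_neq1] := eqVneq a 1; first by rewrite powRr1//; lra.
  have ha : 0 < 1 - a by rewrite subr_gt0 lt_neqAle a1 andbT; exact/eqP.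
  have := @conjugate_powR _ (y `^ a) 1 a^-1 (1 - a)^-1.
  rewrite !invrK !invr_gt0 a0 ha powR_ge0 ler01 -powRrM divff ?gt_eqF//.
  rewrite powRr1// powR1 mulr1 mul1r [y * a]mulrC; apply => //; ring.
have -> : x `^ a = m `^ a * (x / m) `^ a.
  rewrite -powRM ?divr_ge0 ?(ltW m0)//; congr (_ `^ _).
  by field; rewrite gt_eqF.
have := young (x / m) (divr_ge0 x0 (ltW m0)).
rewrite -(ler_pM2l (powR_gt0 a m0)) => /le_trans; apply.
by rewrite le_eqVlt; apply/orP; left; apply/eqP; field; rewrite gt_eqF.
Qed.

(** * Riemann sums and sewing *)

Section young_sums.
Context {R : realType} {e d : nat}.
Implicit Types (g : R -> 'M[R]_(e, d)) (w : R -> 'cV[R]_d).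

(** Recursive form of [riemann_sum] that carries the left endpoint, so that sums can be cut at a
    node and treated by induction on the dissection. *)
Fixpoint rsum g w (a : R) (s : seq R) : 'cV[R]_e :=
  if s is x :: s' then g a *m (w x - w a) + rsum g w x s' else 0.

Lemma riemann_sumE g w s : riemann_sum g w s = rsum g w 0 s.
Proof.
suff H a : \sum_(i < size s) g (nth 0 (a :: s) i) *m
    (w (nth 0 s i) - w (nth 0 (a :: s) i)) = rsum g w a s by exact: H.
elim: s a => [|x s IH] a; first by rewrite big_ord0.
by rewrite /= big_ord_recl /= -IH.
Qed.

Lemma rsum_cat g w a s1 s2 :
  rsum g w a (s1 ++ s2) = rsum g w a s1 + rsum g w (last a s1) s2.
Proof. by elim: s1 a => [|x s IH] a /=; rewrite ?add0r// IH addrA. Qed.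

End young_sums.

Definition holder_bound {R : realType} {m n : nat} (alpha T c : R)
    (f : R -> 'M[R]_(m, n)) : Prop :=
  forall u v, 0 <= u -> u <= v -> v <= T ->
    enorm (f v - f u) <= c * (v - u) `^ alpha.

Lemma holder_boundP {R : realType} {m n : nat} (alpha T c : R)
    (f : R -> 'M[R]_(m, n)) : 0 < alpha ->
  holder_bound alpha T c f <-> (holder_norm edistance alpha T f <= c%:E)%E.
Proof.
move=> a0; split=> [H|H u v u0 uv vT].
  apply: ge_ereal_sup => _ [s [t [s0 st tT ->]]].
  rewrite /edistance -EFinM lee_fin ler_pdivrMr ?powR_gt0 ?subr_gt0//.
  by rewrite enormC H// ltW.
have [->|/eqP uNv] := eqVneq u v.
  by rewrite !subrr enorm0 powR0 ?mulr0// gt_eqF.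
have {}uv : u < v by rewrite lt_neqAle uv andbT; exact/eqP.
rewrite -ler_pdivrMr ?powR_gt0 ?subr_gt0// -lee_fin EFinM enormC.
by apply: le_trans H; apply: ereal_sup_ubound; exists u, v.
Qed.

(** Used with [m] the midpoint: the parts of the path before and after the subinterval that crosses
    [m] each span at most half of the total length. *)
Lemma path_split {R : realType} (a m : R) (s : seq R) : a <= m -> m < last a s ->
  exists s1 x s2, [/\ s = s1 ++ x :: s2, last a s1 <= m & m < x].
Proof.
elim: s a => [|x s IH] a am /=; first by move=> /(le_lt_trans am); rewrite ltxx.
have [xm ml|mx _] := leP x m; last by exists [::], x, s.
have [s1 [y [s2 [-> ? ?]]]] := IH x xm ml.
by exists (x :: s1), y, s2.
Qed.

(** * Sewing estimates by bisection *)

Section sewing.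
Context {R : realType} {e d : nat}.
Variables (alpha beta T p q : R) (g : R -> 'M[R]_(e, d)) (w : R -> 'cV[R]_d).
Hypotheses (alpha0 : 0 <= alpha) (beta0 : 0 <= beta) (ab1 : 1 < alpha + beta).
Hypotheses (p0 : 0 <= p) (q0 : 0 <= q).
Hypotheses (gp : holder_bound alpha T p g) (wq : holder_bound beta T q w).

Definition sewing_const : R := 2 * p * q / (1 - 2 `^ (1 - (alpha + beta))).

Local Notation theta := (alpha + beta).
Local Notation K := sewing_const.

Let half_lt1 : 2 `^ (1 - theta) < 1 :> R.
Proof.
have -> : 1 - theta = - (theta - 1) by ring.
rewrite powRN invf_lt1 ?powR_gt0//.
have := @gt0_ltr_powR R (theta - 1) _ 1 2; rewrite powR1; apply => //.
- by rewrite subr_gt0.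
- by rewrite nnegrE.
- by rewrite nnegrE.
- by rewrite ltr1n.
Qed.

Lemma sewing_const_ge0 : 0 <= K.
Proof. by rewrite divr_ge0 ?mulr_ge0// subr_ge0 ltW. Qed.

Lemma young_increment u v x y L : 0 < L -> 0 <= u -> u <= v -> v <= x ->
    x <= y -> y <= T -> v - u <= L -> y - x <= L ->
  enorm ((g v - g u) *m (w y - w x)) <= p * q * L `^ theta.
Proof.
move=> L0 u0 uv vx xy yT vuL yxL; apply: le_trans (enorm_mulmx _ _) _.
rewrite powRD ?(gt_eqF L0) ?implybT// mulrACA.
have le_pow a z : 0 <= a -> 0 <= z -> z <= L -> z `^ a <= L `^ a.
  by move=> a0 z0 zL; apply: ge0_ler_powR; rewrite ?nnegrE// ltW.
apply: ler_pM; rewrite ?enorm_ge0//.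
  apply: le_trans (gp u v u0 uv _) _; first by lra.
  by rewrite ler_wpM2l// le_pow// subr_ge0.
apply: le_trans (wq x y _ xy yT) _; first by lra.
by rewrite ler_wpM2l// le_pow// subr_ge0.
Qed.

(* Removing the subinterval that contains the midpoint leaves two dissections
   of intervals of at most half the length. *)
Lemma sewing_bound a s : 0 <= a -> last a s <= T -> path <%R a s ->
  enorm (rsum g w a s - g a *m (w (last a s) - w a))
    <= K * (last a s - a) `^ theta.
Proof.
(* Strong induction on the number of nodes, as both remaining pieces are shorter by an unknown
   amount. *)
have [n] := ubnP (size s); elim: n a s => // n IH a s sn a0 lT pas.
have [aT|aNl] := eqVneq a (last a s).
  suff -> : s = [::] by rewrite /= subrr mulmx0 subrr enorm0 subrr
    mulr_ge0 ?sewing_const_ge0 ?powR_ge0.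
  case: s pas aT {sn lT} => //= x s /andP[ax /unstable.path_lt_le_last xl] aE.
  by move: (lt_le_trans ax xl); rewrite -aE ltxx.
have al : a < last a s by rewrite lt_neqAle aNl unstable.path_lt_le_last.
set L := last a s - a; set b := last a s in lT al L *.
have L0 : 0 < L by rewrite subr_gt0.
have [| |s1 [x [s2 [sE s1m mx]]]] := path_split a ((a + b) / 2) s.
- by lra.
- by rewrite -/b; lra.
move: pas sn; rewrite sE cat_path/= size_cat/= => /and3P[pas1 yx pxs2] sn.
have bE : b = last x s2 by rewrite /b sE last_cat.
have ay := unstable.path_lt_le_last pas1; have xb := unstable.path_lt_le_last pxs2.
set y := last a s1 in s1m yx ay *.
have Kmono z : 0 <= z -> z <= L / 2 -> K * z `^ theta <= K * (L / 2) `^ theta.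
  move=> z0 zL; rewrite ler_wpM2l ?sewing_const_ge0//.
  by apply: ge0_ler_powR; rewrite ?nnegrE ?addr_ge0// (le_trans z0).
have IH1 : enorm (rsum g w a s1 - g a *m (w y - w a)) <= K * (L / 2) `^ theta.
  apply: le_trans (IH _ _ _ _ _ _) _ => //.
  - by move: sn; rewrite addnS ltnS; apply: leq_trans; rewrite ltnS leq_addr.
  - by rewrite -/y; lra.
  by apply: Kmono; rewrite -/y /L; lra.
have IH2 : enorm (rsum g w x s2 - g x *m (w b - w x)) <= K * (L / 2) `^ theta.
  rewrite bE; apply: le_trans (IH _ _ _ _ _ _) _ => //.
  - by move: sn; rewrite addnS ltnS; apply: leq_trans; rewrite ltnS leq_addl.
  - by lra.
  - by rewrite -bE.
  by apply: Kmono; rewrite -bE /L; lra.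
(* Splitting [w b - w a] at [y] and [x] leaves the errors of the two pieces, plus the cost of
   replacing [g y] and [g x] by [g a]. *)
have -> : rsum g w a (s1 ++ x :: s2) - g a *m (w b - w a) =
    (rsum g w a s1 - g a *m (w y - w a)) +
    (rsum g w x s2 - g x *m (w b - w x)) +
    (g y - g a) *m (w x - w y) + (g x - g a) *m (w b - w x).
  rewrite rsum_cat/= -/y !(mulmxBl, mulmxBr).
  by apply/matrixP => i j; rewrite !mxE; ring.
have H1 : enorm ((g y - g a) *m (w x - w y)) <= p * q * L `^ theta.
  by apply: young_increment => //; rewrite /L; lra.
have H2 : enorm ((g x - g a) *m (w b - w x)) <= p * q * L `^ theta.
  by apply: young_increment => //; rewrite /L; lra.
(* This identity is the equation that defines [sewing_const]. *)
have -> : K * L `^ theta = K * (L / 2) `^ theta + K * (L / 2) `^ theta +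
    p * q * L `^ theta + p * q * L `^ theta.
  have -> : (L / 2) `^ theta = 2 `^ (1 - theta) / 2 * L `^ theta.
    have h : 2^-1 `^ theta = 2 `^ (- theta) :> R.
      by rewrite -powR_inv1// -powRrM mulN1r.
    rewrite powRM ?invr_ge0 ?(ltW L0)// h (@powRD _ 2 1 (- theta)) ?powRr1//.
      by field.
    by rewrite pnatr_eq0 implybT.
  by rewrite /K; field; rewrite subr_eq0 gt_eqF.
apply: le_trans (enormD _ _) _; apply: lerD => //.
apply: le_trans (enormD _ _) _; apply: lerD => //.
by apply: le_trans (enormD _ _) _; apply: lerD.
Qed.

(** [sewing_bound] applies on each subinterval of [s]. An interval of length [h <= delta] costs at
    most [K * h]^ theta <= K * delta [^ (theta - 1) * h], and the lengths add up to
    [last a s - a]. *)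
Lemma sewing_refine delta a s u : 0 <= a -> last a s <= T ->
    path <%R a s -> path <%R a u -> last a u = last a s -> {subset s <= u} ->
    path (fun x y => y - x <= delta) a s ->
  enorm (rsum g w a u - rsum g w a s)
    <= K * delta `^ (theta - 1) * (last a s - a).
Proof.
elim: s a u => [|x s IH] a u a0 /= lT.
  move=> _ pau lau _ _; suff -> : u = [::] by rewrite subrr enorm0 subrr mulr0.
  case: u pau lau => //= y u /andP[ay /unstable.path_lt_le_last yl] aE.
  by move: (lt_le_trans ay yl); rewrite aE ltxx.
move=> /andP[ax pxs] pau lau su /andP[xad pds].
have xu : x \in u by rewrite su// inE eqxx.
case/path.splitP: xu pau lau su => u1 u2 /=.
rewrite cat_path last_rcons => /andP[pau1 pxu2]; rewrite last_cat last_rcons => lu su.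
have x0 : 0 <= x by rewrite (le_trans a0)// ltW.
(* The later nodes of [s] exceed [x], whereas [u1] lies below [x]. *)
have su2 : {subset s <= u2}.
  move=> z zs; have := su z; rewrite inE zs orbT mem_cat => /(_ erefl) /orP[|//].
  have xz : x < z by have /allP := order_path_min lt_trans pxs; apply.
  rewrite mem_rcons inE gt_eqF//= => zu1.
  have := path_sorted pau1; rewrite (sorted_pairwise lt_trans) pairwise_rcons.
  by move=> /andP[/allP/(_ z zu1)/(lt_trans xz)]; rewrite ltxx.
have IHx : enorm (rsum g w x u2 - rsum g w x s)
    <= K * delta `^ (theta - 1) * (last x s - x) by exact: IH.
have xl := unstable.path_lt_le_last pxs.
have Hx : enorm (rsum g w a (rcons u1 x) - g a *m (w x - w a))
    <= K * delta `^ (theta - 1) * (x - a).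
  have := sewing_bound a (rcons u1 x); rewrite last_rcons => H.
  apply: le_trans (H _ _ _) _ => //; first exact: le_trans lT.
  rewrite -mulrA ler_wpM2l ?sewing_const_ge0//.
  have xa0 : 0 <= x - a by rewrite subr_ge0 ltW.
  have t0 : 0 < theta by rewrite (lt_trans _ ab1).
  rewrite -mulr_powRB1// mulrC ler_wpM2r//; apply: ge0_ler_powR => //.
  - by rewrite subr_ge0 ltW.
  - by rewrite nnegrE (le_trans xa0).
rewrite rsum_cat last_rcons opprD addrACA.
apply: le_trans (enormD _ _) _; apply: le_trans (lerD Hx IHx) _.
by rewrite -mulrDr; apply: ler_wpM2l; [rewrite mulr_ge0 ?sewing_const_ge0 ?powR_ge0|lra].
Qed.

(** Both sums are compared with the sum along the common refinement [u], the sorted union of the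
    nodes. *)
Lemma sewing_compare s1 s2 d1 d2 : 0 < T ->
    path <%R 0 s1 -> last 0 s1 = T -> path (fun x y => y - x <= d1) 0 s1 ->
    path <%R 0 s2 -> last 0 s2 = T -> path (fun x y => y - x <= d2) 0 s2 ->
  enorm (rsum g w 0 s1 - rsum g w 0 s2)
    <= K * T * (d1 `^ (theta - 1) + d2 `^ (theta - 1)).
Proof.
move=> T0 p1 l1 m1 p2 l2 m2.
pose u := sort <=%R (undup (s1 ++ s2)).
have memu z : (z \in u) = (z \in s1) || (z \in s2).
  by rewrite mem_sort mem_undup mem_cat.
have memT s : path <%R 0 s -> last 0 s = T -> T \in s.
  by case: s => [_ /= E|x s _ <- /=]; [rewrite E ltxx in T0|rewrite mem_last].
have le_last s z : path <%R 0 s -> last 0 s = T -> z \in s -> z <= T.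
  move=> ps <- zs; case/path.splitP: zs ps => v1 v2.
  rewrite cat_path last_rcons last_cat last_rcons => /andP[_].
  exact: unstable.path_lt_le_last.
have pu : path <%R 0 u.
  rewrite path_min_sorted ?sort_lt_sorted ?undup_uniq//; apply/allP => z.
  rewrite memu => /orP[] zs.
    by have /allP := order_path_min lt_trans p1; apply.
  by have /allP := order_path_min lt_trans p2; apply.
have lu : last 0 u = T.
  have Tu : T \in u by rewrite memu memT.
  apply/eqP; rewrite eq_le; apply/andP; split; last first.
    case/path.splitP: Tu pu => v1 v2; rewrite cat_path last_rcons last_cat.
    by rewrite last_rcons => /andP[_ /unstable.path_lt_le_last].
  have : last 0 u \in 0 :: u by exact: mem_last.
  rewrite inE => /predU1P[->|]; first exact: ltW.
  by rewrite memu => /orP[]; exact: le_last.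
have H s dl : path <%R 0 s -> last 0 s = T ->
    path (fun x y => y - x <= dl) 0 s -> {subset s <= u} ->
    enorm (rsum g w 0 u - rsum g w 0 s) <= K * dl `^ (theta - 1) * T.
  move=> ps ls ms su; have := @sewing_refine dl 0 s u.
  by rewrite ls lu subr0; apply.
apply: le_trans (enorm_triangle (rsum g w 0 u) _ _) _.
have h1 : enorm (rsum g w 0 s1 - rsum g w 0 u) <= K * d1 `^ (theta - 1) * T.
  by rewrite enormC; apply: H => // z; rewrite memu => ->.
have h2 : enorm (rsum g w 0 u - rsum g w 0 s2) <= K * d2 `^ (theta - 1) * T.
  by apply: H => // z; rewrite memu orbC => ->.
by apply: le_trans (lerD h1 h2) _; lra.
Qed.

End sewing.

(** * The Young integral *)

Lemma powR_small {R : realType} (C c eps : R) : 0 <= C -> 0 < c -> 0 < eps ->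
  exists2 delta : R, 0 < delta &
    forall x, 0 <= x -> x < delta -> C * x `^ c < eps.
Proof.
(* [C + 1] replaces [C], which may be zero, as a divisor. *)
move=> C0 c0 eps0; have C1 : 0 < C + 1 by lra.
have r0 : 0 < eps / (C + 1) by rewrite divr_gt0.
exists ((eps / (C + 1)) `^ c^-1); first by rewrite powR_gt0.
move=> x x0 xd; apply: (@le_lt_trans _ _ (C * (eps / (C + 1)))).
  rewrite ler_wpM2l//; have := @ge0_ler_powR R c (ltW c0) x _ _ _ (ltW xd).
  rewrite -powRrM mulVf ?gt_eqF// powRr1 ?(ltW r0)//.
  by apply; rewrite nnegrE ?powR_ge0.
by rewrite mulrA ltr_pdivrMr//; nra.
Qed.

Lemma cvg_enorm {R : realType} {m n : nat} {I : Type} (F : set_system I)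
    {FF : Filter F} (f : I -> 'M[R]_(m, n)) (l : 'M[R]_(m, n)) :
  f x @[x --> F] --> l ->
  forall eps, 0 < eps -> \forall x \near F, enorm (f x - l) < eps.
Proof.
move=> fl eps eps0; set c := Num.sqrt (m * n)%:R : R.
have c0 : 0 <= c by exact: sqrtr_ge0.
have c1 : 0 < c + 1 by lra.
near=> x; have : `|f x - l| < eps / (c + 1).
  by near: x; apply: (cvgr_distC_lt _ _ fl); rewrite divr_gt0.
rewrite ltr_pdivlMr// => fx.
apply: le_lt_trans (enorm_le_normr _) _; apply: le_lt_trans fx.
by rewrite [leRHS]mulrC ler_wpM2r// -/c lerDl.
Unshelve. all: by end_near. Qed.

Lemma mesh_path {R : realType} (s : seq R) :
  path (fun x y => y - x <= mesh s) 0 s.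
Proof.
apply/(pathP 0) => i si.
exact: (le_bigmax _ (fun i : 'I_(size s) => node s i.+1 - node s i) (Ordinal si)).
Qed.

Lemma mesh_ge0 {R : realType} (s : seq R) : 0 <= mesh s.
Proof. exact: bigmax_ge_id. Qed.

Lemma node_le {R : realType} (s : seq R) k l : path <%R 0 s ->
  (k <= l)%N -> (l <= size s)%N -> node s k <= node s l.
Proof.
move=> ps kl ls; apply: (sorted_leq_nth le_trans lexx) => //.
- exact: (sub_path (fun x y => @ltW _ _ x y)).
- by rewrite inE /= ltnS (leq_trans kl).
Qed.

Lemma dissection_node {R : realType} (T : R) (s : seq R) i :
    dissection T s -> (i < size s)%N ->
  [/\ 0 <= node s i, node s i.+1 <= T, node s i < node s i.+1
    & node s i.+1 - node s i <= mesh s].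
Proof.
move=> [ps /eqP ls] si; split.
- exact: (node_le s 0 i ps (leq0n _) (ltnW si)).
- have := node_le s i.+1 (size s) ps si (leqnn _).
  by rewrite {2}/node -(last_nth 0) ls.
- by move: i si; apply/(pathP 0).
- by have /(pathP 0)/(_ i si) := mesh_path s.
Qed.

Section young_integral.
Context {R : realType} {e d : nat}.
Variables (alpha beta T p q : R) (g : R -> 'M[R]_(e, d)) (w : R -> 'cV[R]_d).
Hypotheses (T0 : 0 < T) (alpha0 : 0 <= alpha) (beta0 : 0 <= beta).
Hypotheses (ab1 : 1 < alpha + beta) (p0 : 0 <= p) (q0 : 0 <= q).
Hypotheses (gp : holder_bound alpha T p g) (wq : holder_bound beta T q w).
Variable D : nat -> seq R.
Hypotheses (dissD : forall n, dissection T (D n))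
  (meshD : mesh (D n) @[n --> \oo] --> (0 : R)).

Local Notation theta := (alpha + beta).
Local Notation C := (sewing_const alpha beta p q * T).

Let theta1 : 0 < theta - 1. Proof. by rewrite subr_gt0. Qed.

Let C0 : 0 <= C.
Proof. by rewrite mulr_ge0 ?sewing_const_ge0// ltW. Qed.

Lemma riemann_compare s1 s2 : dissection T s1 -> dissection T s2 ->
  enorm (riemann_sum g w s1 - riemann_sum g w s2)
    <= C * mesh s1 `^ (theta - 1) + C * mesh s2 `^ (theta - 1).
Proof.
move=> [ps1 /eqP l1] [ps2 /eqP l2]; rewrite !riemann_sumE -mulrDr.
by apply: sewing_compare => //; exact: mesh_path.
Qed.

Lemma mesh_lt eps : 0 < eps -> \forall n \near \oo, mesh (D n) < eps.
Proof.
move=> eps0; near=> n; rewrite -[ltLHS]subr0; apply: le_lt_trans (ler_norm _) _.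
by near: n; exact: cvgr_distC_lt.
Unshelve. all: by end_near. Qed.

Lemma mesh_powR_small eps : 0 < eps ->
  \forall n \near \oo, C * mesh (D n) `^ (theta - 1) < eps.
Proof.
move=> eps0; have [dl dl0 H] := powR_small _ _ _ C0 theta1 eps0.
near=> n; apply: H; first exact: mesh_ge0.
near: n; exact: mesh_lt.
Unshelve. all: by end_near. Qed.

(** By [riemann_compare] the sums along [D] are Cauchy. Comparing an arbitrary [s] with [D n] and
    letting [n] grow leaves only the mesh of [s] in the bound. *)
Lemma riemann_limit : exists I, forall s, dissection T s ->
  enorm (riemann_sum g w s - I) <= C * mesh s `^ (theta - 1).
Proof.
pose u n := riemann_sum g w (D n).
have /cvg_ex[I uI] : cvg (u @ \oo).
  apply/cauchy_cvgP/cauchy_exP => eps eps0.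
  have [N _ HN] := mesh_powR_small _ (divr_gt0 eps0 (ltr0n _ 2)).
  exists (u N); exists N => // n /= Nn; rewrite -ball_normE/=.
  apply: le_lt_trans (normr_le_enorm _) _.
  apply: le_lt_trans (riemann_compare _ _ _ _) _ => //.
  by have := HN _ (leqnn N); have := HN _ Nn; rewrite /=; lra.
exists I => s ds; apply/ler_addgt0Pr => eps eps0.
have e2 := divr_gt0 eps0 (ltr0n R 2).
near \oo => n.
have h1 : enorm (u n - I) < eps / 2 by near: n; exact: cvg_enorm.
have h2 : C * mesh (D n) `^ (theta - 1) < eps / 2.
  by near: n; exact: mesh_powR_small.
apply: le_trans (enorm_triangle (u n) _ _) _.
by have := riemann_compare s (D n) ds (dissD n); rewrite -/(u n); lra.
Unshelve. all: by end_near. Qed.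

Lemma is_young_integral_riemann (I : 'cV[R]_e) :
  (forall s, dissection T s ->
     enorm (riemann_sum g w s - I) <= C * mesh s `^ (theta - 1)) ->
  is_young_integral T g w I.
Proof.
move=> HI eps eps0; have [dl dl0 H] := powR_small _ _ _ C0 theta1 eps0.
exists dl => // s ds ms; apply: le_lt_trans (HI _ ds) _.
by apply: H => //; exact: mesh_ge0.
Qed.

(** [young_integral] is a chosen limit [J]. Existence excludes the default value of [xget], and the
    rate for [J] follows by passing through a fine [D n], along which the sums are close to [J]. *)
Lemma young_integral_bound s : dissection T s ->
  enorm (riemann_sum g w s - young_integral T g w)
    <= C * mesh s `^ (theta - 1).
Proof.
move=> ds; have [I HI] := riemann_limit.
have /xgetPex : exists J, [set J | is_young_integral T g w J] J.
  by exists I; exact: is_young_integral_riemann.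
move=> /(_ 0) HJ; rewrite /young_integral; set J := xget _ _ in HJ *.
apply/ler_addgt0Pr => eps eps0; have e2 := divr_gt0 eps0 (ltr0n R 2).
have [dl dl0 H] := HJ _ e2.
near \oo => n.
have h1 : enorm (riemann_sum g w (D n) - J) < eps / 2.
  by apply: H => //; near: n; exact: mesh_lt.
have h2 : C * mesh (D n) `^ (theta - 1) < eps / 2.
  by near: n; exact: mesh_powR_small.
apply: le_trans (enorm_triangle (riemann_sum g w (D n)) _ _) _.
by have := riemann_compare s (D n) ds (dissD n); lra.
Unshelve. all: by end_near. Qed.

End young_integral.

(** * Piecewise linear interpolation *)

Section interpolation.
Context {R : realType} {m n : nat}.
Implicit Types (g : R -> 'M[R]_(m, n)) (s : seq R).

Definition interp2 g (a b t : R) : 'M[R]_(m, n) :=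
  ((b - t) / (b - a)) *: g a + ((t - a) / (b - a)) *: g b.

Fixpoint interp g (a : R) s (t : R) : 'M[R]_(m, n) :=
  if s is x :: s' then if t <= x then interp2 g a x t else interp g x s' t
  else g a.

Lemma interp_locate g a s t : a < last a s -> a <= t <= last a s ->
  exists i, [/\ (i < size s)%N, nth 0 (a :: s) i <= t <= nth 0 s i
    & interp g a s t = interp2 g (nth 0 (a :: s) i) (nth 0 s i) t].
Proof.
elim: s a => [|x s IH] a /=; first by rewrite ltxx.
move=> al /andP[at_ tl]; case: leP => [tx|xt]; first by exists 0; rewrite /= at_ tx.
have [i [si it iE]] := IH x (lt_le_trans xt tl) (introT andP (conj (ltW xt) tl)).
by exists i.+1.
Qed.

(** The last node is excluded: a Riemann sum evaluates its integrand at left endpoints only. *)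
Lemma interp_node g a s i : path <%R a s -> (i < size s)%N ->
  interp g a s (nth 0 (a :: s) i) = g (nth 0 (a :: s) i).
Proof.
elim: s a i => [|x s IH] a [|i] //=.
  move=> /andP[ax _] _; rewrite (ltW ax) /interp2 subrr mul0r scale0r addr0.
  by rewrite divff ?scale1r// subr_eq0 gt_eqF.
move=> /andP[ax pxs] si; case: i si => [|i] si /=.
  rewrite lexx /interp2 subrr mul0r scale0r add0r.
  by rewrite divff ?scale1r// subr_eq0 gt_eqF.
have /allP/(_ (nth 0 s i)) := order_path_min lt_trans pxs.
rewrite mem_nth// => [/(_ erefl)|]; last exact: ltnW.
by rewrite ltNge => /negbTE ->; exact: (IH x i.+1).
Qed.

Lemma enorm_conv4 (k1 k2 k3 k4 b1 b2 b3 b4 : R) (x1 x2 x3 x4 : 'M[R]_(m, n)) :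
  0 <= k1 -> 0 <= k2 -> 0 <= k3 -> 0 <= k4 ->
  enorm x1 <= b1 -> enorm x2 <= b2 -> enorm x3 <= b3 -> enorm x4 <= b4 ->
  enorm (k1 *: x1 + k2 *: x2 + k3 *: x3 + k4 *: x4)
    <= k1 * b1 + k2 * b2 + k3 * b3 + k4 * b4.
Proof.
move=> k10 k20 k30 k40 h1 h2 h3 h4.
have H k x b : 0 <= k -> enorm x <= b -> enorm (k *: x : 'M[R]_(m, n)) <= k * b.
  by move=> k0 xb; rewrite enormZ ger0_norm// ler_wpM2l.
do 3 (apply: le_trans (enormD _ _) _; apply: lerD; last exact: H).
exact: H.
Qed.

(* The majorant [x |-> A * x + B] is the tangent at [v - u], so the bound is
   Jensen's inequality for the concave modulus [p * x `^ alpha]. *)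
Lemma interp2_holder (alpha T p : R) g (a b c d u v : R) : 0 < alpha <= 1 ->
  0 <= p -> holder_bound alpha T p g -> 0 <= a -> a < b -> c < d -> d <= T ->
  a <= u <= b -> c <= v <= d -> u < v -> (a = c /\ b = d) \/ b <= c ->
  enorm (interp2 g c d v - interp2 g a b u) <= p * (v - u) `^ alpha.
Proof.
move=> a01 p0 gp a0 ab cd dT /andP[au ub] /andP[cv vd] uv.
have uv0 : 0 < v - u by rewrite subr_gt0.
have := powR_tangent alpha (v - u) a01 uv0.
set A := alpha * (v - u) `^ alpha / (v - u); set B := (1 - alpha) * _ => tan.
have tanE : (v - u) `^ alpha = A * (v - u) + B.
  by rewrite /A /B; field; rewrite gt_eqF.
have B0 : 0 <= B by rewrite mulr_ge0 ?powR_ge0// subr_ge0; case/andP: a01.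
have lin x y : 0 <= x -> x <= y -> y <= T ->
    enorm (g y - g x) <= p * (A * (y - x) + B).
  move=> x0 xy yT; apply: le_trans (gp x y x0 xy yT) _.
  by rewrite ler_wpM2l// tan// subr_ge0.
rewrite tanE => -[[ac bd]|bc].
  rewrite -{}ac -{}bd in cd cv vd dT *.
  (* On a single piece the increment is a fraction, at most 1, of [g b - g a]; the fraction
     multiplies [B] too, which only lowers the bound. *)
  have -> : interp2 g a b v - interp2 g a b u = ((v - u) / (b - a)) *: (g b - g a).
    rewrite /interp2; apply/matrixP => i j; rewrite !mxE; field.
    by rewrite subr_eq0 gt_eqF.
  have ba0 : 0 < b - a by rewrite subr_gt0.
  have k0 : 0 <= (v - u) / (b - a) by rewrite divr_ge0// ltW.
  have k1 : (v - u) / (b - a) <= 1 by rewrite ler_pdivrMr//; lra.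
  rewrite enormZ ger0_norm//.
  apply: le_trans (ler_wpM2l k0 (lin a b a0 (ltW ab) dT)) _.
  have -> : (v - u) / (b - a) * (p * (A * (b - a) + B)) =
      p * (A * (v - u) + (v - u) / (b - a) * B) by field; rewrite gt_eqF.
  by rewrite ler_wpM2l// lerD2l ler_piMl.
have ba0 : b - a != 0 by rewrite subr_eq0 gt_eqF.
have dc0 : d - c != 0 by rewrite subr_eq0 gt_eqF.
pose la := (b - u) / (b - a); pose mu := (d - v) / (d - c).
have la0 : 0 <= la by rewrite divr_ge0// subr_ge0// ltW.
have la1 : 0 <= 1 - la by rewrite subr_ge0 ler_pdivrMr ?subr_gt0//; lra.
have mu0 : 0 <= mu by rewrite divr_ge0// subr_ge0// ltW.
have mu1 : 0 <= 1 - mu by rewrite subr_ge0 ler_pdivrMr ?subr_gt0//; lra.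
(* On distinct pieces the increment is a convex combination of four increments between nodes. The
   mean of the four distances with these weights is [v - u], so the affine majorant averages
   exactly; [b <= c] makes all four distances nonnegative. *)
have -> : interp2 g c d v - interp2 g a b u =
    (la * mu) *: (g c - g a) + (la * (1 - mu)) *: (g d - g a) +
    ((1 - la) * mu) *: (g c - g b) + ((1 - la) * (1 - mu)) *: (g d - g b).
  rewrite /interp2 /la /mu; apply/matrixP => i j; rewrite !mxE; field.
  by rewrite ba0 dc0.
have -> : p * (A * (v - u) + B) =
    (la * mu) * (p * (A * (c - a) + B)) + (la * (1 - mu)) * (p * (A * (d - a) + B)) +
    ((1 - la) * mu) * (p * (A * (c - b) + B)) +
    ((1 - la) * (1 - mu)) * (p * (A * (d - b) + B)).
  rewrite /la /mu; field.
  by rewrite ba0 dc0.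
by clearbody la mu; apply: enorm_conv4; rewrite ?mulr_ge0//; apply: lin; lra.
Qed.

Lemma interp_holder (alpha T p : R) g s : 0 < T -> 0 < alpha <= 1 -> 0 <= p ->
  dissection T s -> holder_bound alpha T p g ->
  holder_bound alpha T p (interp g 0 s).
Proof.
move=> T0 a01 p0 [ps /eqP lsT] gp u v u0 uv vT.
have [->|uNv] := eqVneq u v.
  by rewrite subrr enorm0 mulr_ge0// powR_ge0.
have {uNv}uv' : u < v by rewrite lt_neqAle uNv.
have l0 : 0 < last 0 s by rewrite lsT.
have [|i [si iu ->]] := interp_locate g 0 s u l0; first by rewrite u0 lsT (le_trans uv).
have [|j [sj jv ->]] := interp_locate g 0 s v l0; first by rewrite (le_trans u0)// lsT.
have [n0 _ nii _] := dissection_node T s i (conj ps (introT eqP lsT)) si.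
have [_ nT njj _] := dissection_node T s j (conj ps (introT eqP lsT)) sj.
apply: (interp2_holder alpha T) => //.
have [->|] := eqVneq i j; first by left.
rewrite neq_ltn => /orP[ij|ji]; right; first exact: (node_le s i.+1 j ps ij (ltnW sj)).
(* Here the piece of [v] would lie to the left of the piece of [u], against [u < v]. *)
have := node_le s j.+1 i ps ji (ltnW si); rewrite /node /= => h.
by move: iu jv => /andP[? ?] /andP[? ?]; lra.
Qed.

Lemma interp_riemann_sum g (w : R -> 'M[R]_(n, 1)) T s : dissection T s ->
  riemann_sum (interp g 0 s) w s = riemann_sum g w s.
Proof.
by move=> [ps _]; apply: eq_bigr => i _; rewrite /node interp_node.
Qed.

End interpolation.

(** The bound controls [g] on [[0, T]] only, so [g] is composed with the projection [cl] of the line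
    onto [[0, T]]. The composite is continuous everywhere and has the same preimages within
    [[0, T]]. *)
Lemma holder_measurable {R : realType} {m n : nat} (alpha T p : R)
    (g : R -> 'M[R]_(m, n)) :
  0 < T -> 0 < alpha -> 0 <= p -> holder_bound alpha T p g ->
  measurable_fun (`[0, T] : set (measurableTypeR R))
    (g : _ -> g_sigma_algebraType (@open 'M[R]_(m, n))).
Proof.
move=> T0 a0 p0 gp.
pose cl (x : R) := Num.max 0 (Num.min T x).
have clI x : 0 <= cl x <= T.
  by rewrite le_max lexx/= ge_max ge_min lexx ltW.
have cl_id x : 0 <= x <= T -> cl x = x.
  by move=> /andP[x0 xT]; rewrite /cl min_r// max_r.
have cl_lip x y : x <= y -> 0 <= cl y - cl x <= y - x.
  move=> xy; rewrite /cl.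
  by case: (leP T x) => ?; case: (leP T y) => ?; case: (leP 0 T) => ?;
    case: (leP 0 x) => ?; case: (leP 0 y) => ?; lra.
have gcl x y : enorm (g (cl x) - g (cl y)) <= p * `|x - y| `^ alpha.
  wlog xy : x y / y <= x => [H|].
    by have [/H//|/ltW/H] := leP y x; rewrite enormC distrC.
  have /andP[c0 c1] := cl_lip _ _ xy; rewrite ger0_norm ?subr_ge0//.
  have /andP[y0 yT] := clI y; have /andP[x0 xT] := clI x.
  apply: le_trans (gp (cl y) (cl x) y0 _ xT) _; first by rewrite -subr_ge0.
  rewrite ler_wpM2l//; apply: ge0_ler_powR => //; rewrite ?nnegrE ?(ltW a0)//.
  by rewrite subr_ge0.
have cont : continuous (g \o cl).
  move=> x; apply/cvgrPdist_lt => eps eps0.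
  have [dl dl0 H] := powR_small p alpha eps p0 a0 eps0.
  near=> y; have xy : `|x - y| < dl.
    by near: y; exact: (cvgr_dist_lt _ _ (@cvg_id _ _)).
  apply: le_lt_trans (normr_le_enorm _) _.
  by apply: le_lt_trans (gcl _ _) _; exact: H.
apply: (@measurability _ _ (measurableTypeR R)
  (g_sigma_algebraType (@open 'M[R]_(m, n))) _ _ (@open 'M[R]_(m, n)) erefl).
move=> _ [V oV <-].
have -> : `[0, T] `&` g @^-1` V = `[0, T] `&` (g \o cl) @^-1` V.
  by apply/seteqP; split => x [xT /=];
    move: (xT); rewrite /= in_itv/= => /cl_id xE; rewrite xE.
apply: measurableI; first exact: measurable_itv.
by apply: measurable_realfun.open_measurable; move/continuousP: cont; apply.
Unshelve. all: by end_near. Qed.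

(** * Hausdorff distance and Hoelder multifunctions *)

Lemma convex_compact_conv {R : realType} {m n : nat} (C : set 'M[R]_(m, n)) k x y :
  convex_compact C -> 0 <= k <= 1 -> C x -> C y -> C (k *: x + (1 - k) *: y).
Proof.
move=> [_ _ cC] /andP[k0 k1] Cx Cy; apply/set_mem.
exact: (cC x y (Itv01 k0 k1) (mem_set Cx) (mem_set Cy)).
Qed.

(** The strict inequality supplies an admissible radius below [c]; for arbitrary sets the infimum
    may not be attained. *)
Lemma hausdorff_lt {R : realType} {m n : nat} (A B : set 'M[R]_(m, n)) (c : R) :
  (hausdorff A B < c%:E)%E ->
  (forall a, A a -> exists2 b, B b & enorm (a - b) <= c) /\
  (forall b, B b -> exists2 a, A a & enorm (a - b) <= c).
Proof.
move=> /ereal_inf_lt[_ [k [k0 AB BA] <-]]; rewrite lte_fin => /ltW kc.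
split=> [a /AB[b Bb]|b /BA[a Aa]] /le_trans/(_ kc) abc; first by exists b.
by exists a.
Qed.

Lemma hausdorff_le {R : realType} {m n : nat} (A B : set 'M[R]_(m, n)) (c : R) :
  0 <= c -> (forall a, A a -> exists2 b, B b & enorm (a - b) <= c) ->
  (forall b, B b -> exists2 a, A a & enorm (a - b) <= c) ->
  (hausdorff A B <= c%:E)%E.
Proof. by move=> c0 AB BA; apply: ereal_inf_lbound; exists c. Qed.

Lemma hausdorff_ge0 {R : realType} {m n : nat} (A B : set 'M[R]_(m, n)) :
  (0 <= hausdorff A B)%E.
Proof. by apply: le_ereal_inf_tmp => _ [k [k0 _ _] <-]; rewrite lee_fin. Qed.

Lemma holder_norm_fin {R : realType} {X : Type} (dist : X -> X -> \bar R)
    (alpha T : R) (f : R -> X) : (holder_norm dist alpha T f < +oo)%E ->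
  exists2 c : R, 0 <= c & (holder_norm dist alpha T f <= c%:E)%E.
Proof.
case: holder_norm => [r _|//|_]; last by exists 0; rewrite ?leNye.
by exists `|r|; rewrite ?lee_fin ?ler_norm.
Qed.

Lemma holder_multifun_bound {R : realType} {m n : nat} (alpha T : R)
    (F : R -> set 'M[R]_(m, n)) : holder_multifun alpha T F ->
  exists2 c : R, 0 <= c & forall u v, 0 <= u <= T -> 0 <= v <= T ->
    forall a, F u a -> exists2 b, F v b & enorm (a - b) <= c * `|v - u| `^ alpha.
Proof.
(* Passing to [c + 1] gives the strict bound that [hausdorff_lt] asks for. *)
move=> [_ /holder_norm_fin[c c0 Fc]]; exists (c + 1); first exact: addr_ge0.
have H s t : 0 <= s -> s < t -> t <= T ->
    (hausdorff (F s) (F t) < ((c + 1) * (t - s) `^ alpha)%:E)%E.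
  move=> s0 st tT; have ts0 : 0 < (t - s) `^ alpha by rewrite powR_gt0 ?subr_gt0.
  apply: (@le_lt_trans _ _ (c * (t - s) `^ alpha)%:E).
    rewrite EFinM -lee_pdivrMr//; apply: le_trans Fc.
    by apply: ereal_sup_ubound; exists s, t.
  by rewrite lte_fin ltr_pM2r// ltrDl.
move=> u v /andP[u0 uT] /andP[v0 vT] a Fa.
case: (ltgtP u v) => [uv|vu|uv].
- rewrite ger0_norm ?subr_ge0 ?(ltW uv)//.
  by have [+ _] := hausdorff_lt _ _ _ (H u v u0 uv vT); apply.
- have [_ /(_ a Fa)[b Fb ab]] := hausdorff_lt _ _ _ (H v u v0 vu uT).
  by exists b => //; rewrite enormC distrC ger0_norm// subr_ge0 ltW.
- by exists a; rewrite -?uv// subrr enorm0 mulr_ge0 ?powR_ge0 ?addr_ge0.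
Qed.

(** * Distance from the interpolated multifunction to the original one *)

Section multifun_interpolation.
Context {R : realType} {m n : nat}.
Variables (alpha T c delta : R) (F : R -> set 'M[R]_(m, n)).
Hypotheses (alpha0 : 0 <= alpha) (c0 : 0 <= c).
Hypothesis (cF : forall t, 0 <= t <= T -> convex_compact (F t)).
Hypothesis (Fc : forall u v, 0 <= u <= T -> 0 <= v <= T ->
  forall a, F u a -> exists2 b, F v b & enorm (a - b) <= c * `|v - u| `^ alpha).

(** The two endpoints of the combination have nearby points in [F t]; combining these with the same
    weights stays in [F t] by convexity and keeps the error bound. *)
Lemma interp_multifun_close a b t x : 0 <= a -> b <= T -> a <= t <= b -> a < b ->
  b - a <= delta ->
  minkowski_add (minkowski_scale ((b - t) / (b - a)) (F a))
                (minkowski_scale ((t - a) / (b - a)) (F b)) x ->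
  exists2 y, F t y & enorm (x - y) <= c * delta `^ alpha.
Proof.
move=> a0 bT /andP[at_ tb] ab bad [_ [xa Fxa <-] [_ [xb Fxb <-] <-]].
have ba0 : 0 < b - a by rewrite subr_gt0.
set k := (b - t) / (b - a).
have k1 : (t - a) / (b - a) = 1 - k by rewrite /k; field; rewrite gt_eqF.
have k01 : 0 <= k <= 1.
  by rewrite divr_ge0 ?subr_ge0 ?(ltW ab)//= ler_pdivrMr//; lra.
have It : 0 <= t <= T by lra.
have near_F u z : 0 <= u <= T -> `|t - u| <= delta -> F u z ->
    exists2 y, F t y & enorm (z - y) <= c * delta `^ alpha.
  move=> Iu tud Fz; have [y Fy zy] := Fc _ _ Iu It _ Fz.
  exists y => //; apply: le_trans zy _; rewrite ler_wpM2l//.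
  by apply: ge0_ler_powR; rewrite ?nnegrE// (le_trans _ tud).
have [| |ya Fya hya] := near_F a xa _ _ Fxa; [lra|rewrite ger0_norm; lra|].
have [| |yb Fyb hyb] := near_F b xb _ _ Fxb; [lra|rewrite ler0_norm; lra|].
exists (k *: ya + (1 - k) *: yb); first exact: convex_compact_conv (cF _ It) _ _ _.
rewrite k1 opprD addrACA -!scalerBr.
apply: le_trans (enormD _ _) _; rewrite !enormZ.
case/andP: k01 => k0 k1'; rewrite !ger0_norm ?subr_ge0//.
have -> : c * delta `^ alpha = k * (c * delta `^ alpha) + (1 - k) * (c * delta `^ alpha).
  by ring.
by apply: lerD; apply: ler_wpM2l => //; rewrite subr_ge0.
Qed.

End multifun_interpolation.

(** * Convergence of the images *)

(** The values of [h] may be [+oo] at first, as is the distance from an empty to a nonempty set;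
    eventual finiteness is settled before passing to real limits. *)
Lemma ereal_cvg0 {R : realType} (h : nat -> \bar R) :
  (forall n, 0 <= h n)%E ->
  (forall eps : R, 0 < eps -> \forall n \near \oo, (h n <= eps%:E)%E) ->
  h n @[n --> \oo] --> 0%E.
Proof.
move=> h0 hle; have hfin : \forall n \near \oo, h n \is a fin_num.
  near=> n; rewrite ge0_fin_numE//; apply: (@le_lt_trans _ _ 1%:E).
    by near: n; exact: hle.
  exact: ltry.
apply/fine_cvgP; split => //; apply/cvgrPdist_le => eps eps0.
near=> n; rewrite sub0r normrN ger0_norm ?fine_ge0//= -lee_fin fineK.
  by near: n; exact: hle.
by near: n.
Unshelve. all: by end_near. Qed.

(** * Pointwise limits along an ultrafilter *)

Section ultrafilter_limit.
Context {R : realType} {e d : nat} {I : Type}.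
Variables (T : R) (U : set_system I).
Context {UU : UltraFilter U}.

(** The image of an ultrafilter converges in every compact set that it charges, so the same [U]
    yields a limit at all times [t] simultaneously. *)
Lemma ultra_selection (F : R -> set 'M[R]_(e, d)) (g : I -> R -> 'M[R]_(e, d))
    (b : I -> R) :
  (forall t, 0 <= t <= T -> convex_compact (F t)) ->
  (forall eps, 0 < eps -> \forall i \near U, b i < eps) ->
  (\forall i \near U, forall t, 0 <= t <= T ->
     exists2 y, F t y & enorm (g i t - y) <= b i) ->
  exists f, forall t, 0 <= t <= T -> F t (f t) /\
    forall eps, 0 < eps -> \forall i \near U, enorm (g i t - f t) < eps.
Proof.
move=> cF b0 gb.
suff H t : exists p, 0 <= t <= T -> F t p /\
    forall eps, 0 < eps -> \forall i \near U, enorm (g i t - p) < eps.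
  by have [f Hf] := choice H; exists f.
have [tT|] := pselect (0 <= t <= T); last by exists 0.
have [[z Fz] compF _] := cF t tT.
(* Indices without a close point receive the arbitrary point [z], so that [y] always takes values in
   [F t]. *)
have /choice[y Hy] : forall i, exists y, F t y /\
    ((exists2 y, F t y & enorm (g i t - y) <= b i) -> enorm (g i t - y) <= b i).
  move=> i; have [[y Fy gy]|nex] :=
    pselect (exists2 y, F t y & enorm (g i t - y) <= b i); first by exists y.
  by exists z.
have yF : \forall i \near U, F t (y i) by apply: filterE => i; have [] := Hy i.
have [p [Fp yp]] : F t `&` cluster (y @ U) !=set0 by exact: compF.
(* A cluster point of an ultrafilter is a limit: otherwise [U] would contain the complement of the
   preimage of a ball around [p], and the cluster property would give a point both inside and
   outside that ball. *)
have {}yp eps : 0 < eps -> \forall i \near U, enorm (y i - p) < eps.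
  move=> eps0; have [//|nU] :=
    in_ultra_setVsetC [set i | enorm (y i - p) < eps] UU.
  have pB : nbhs p [set z | enorm (z - p) < eps].
    exact: (cvg_enorm (nbhs p) id p (@cvg_id _ _)).
  by have [x [/= xN xB]] := yp [set z | ~ enorm (z - p) < eps] _ nU pB.
exists p => _; split=> // eps eps0; have e2 := divr_gt0 eps0 (ltr0n R 2).
near=> i.
have h1 : enorm (y i - p) < eps / 2 by near: i; exact: yp.
have h2 : b i < eps / 2 by near: i; exact: b0.
have h3 : enorm (g i t - y i) <= b i.
  have [_] := Hy i; apply; have : forall t, 0 <= t <= T ->
    exists2 y, F t y & enorm (g i t - y) <= b i by near: i.
  exact.
by have := enorm_triangle (y i) (g i t) p; lra.
Unshelve. all: by end_near. Qed.

(** Along a fixed dissection only finitely many values of the integrand enter, so pointwise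
    convergence suffices. *)
Lemma rsum_pointwise_cvg (g : I -> R -> 'M[R]_(e, d)) f (w : R -> 'cV[R]_d) a s :
  (forall t, 0 <= t <= T ->
     forall eps, 0 < eps -> \forall i \near U, enorm (g i t - f t) < eps) ->
  0 <= a -> path <%R a s -> last a s <= T ->
  forall eps, 0 < eps ->
    \forall i \near U, enorm (rsum (g i) w a s - rsum f w a s) < eps.
Proof.
move=> gf; elim: s a => [|x s IH] a a0 /= pas lT eps eps0.
  by apply: filterE => i; rewrite subrr enorm0.
have /andP[ax pxs] := pas; have xl := unstable.path_lt_le_last pxs.
have e2 := divr_gt0 eps0 (ltr0n R 2).
set W := enorm (w x - w a).
have W1 : 0 < W + 1 by have := enorm_ge0 (w x - w a); rewrite -/W; lra.
near=> i.
have h1 : enorm (g i a - f a) < eps / 2 / (W + 1).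
  by near: i; apply: gf; [lra|rewrite divr_gt0].
have h2 : enorm (rsum (g i) w x s - rsum f w x s) < eps / 2.
  by near: i; apply: IH => //; lra.
rewrite opprD addrACA -mulmxBl.
apply: le_lt_trans (enormD _ _) _; apply: le_lt_trans (lerD (enorm_mulmx _ _) (lexx _)) _.
rewrite -/W; move: h1; rewrite ltr_pdivlMr// => h1.
have := enorm_ge0 (g i a - f a).
by rewrite [ltRHS](_ : _ = eps / 2 + eps / 2); [nra|field].
Unshelve. all: by end_near. Qed.

End ultrafilter_limit.

(** * The two one-sided estimates between the images *)

Section convergence.
Context {R : realType} {e d : nat}.
Variables (T alpha beta r q c : R) (F : R -> set 'M[R]_(e, d)) (w : R -> 'cV[R]_d).
Variables (D : nat -> seq R) (Fn : nat -> R -> set 'M[R]_(e, d)).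
Hypotheses (T0 : 0 < T) (alpha01 : 0 < alpha <= 1) (beta0 : 0 <= beta).
Hypotheses (ab1 : 1 < alpha + beta) (q0 : 0 <= q) (c0 : 0 <= c).
Hypothesis (wq : holder_bound beta T q w).
Hypothesis (cF : forall t, 0 <= t <= T -> convex_compact (F t)).
Hypothesis (Fc : forall u v, 0 <= u <= T -> 0 <= v <= T ->
  forall a, F u a -> exists2 b, F v b & enorm (a - b) <= c * `|v - u| `^ alpha).
Hypotheses (dissD : forall n, dissection T (D n))
  (meshD : mesh (D n) @[n --> \oo] --> (0 : R)).
Hypothesis FnE : forall n i t, (i < size (D n))%N ->
  node (D n) i <= t <= node (D n) i.+1 ->
  let h := node (D n) i.+1 - node (D n) i in
  Fn n t = minkowski_add
    (minkowski_scale ((node (D n) i.+1 - t) / h) (F (node (D n) i)))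
    (minkowski_scale ((t - node (D n) i) / h) (F (node (D n) i.+1))).

Let alpha0 : 0 < alpha. Proof. by case/andP: alpha01. Qed.

Local Notation C := (sewing_const alpha beta r q * T).
Local Notation theta := (alpha + beta).

(** The sign of [r] is read off from the increment of a selection over the whole of [[0, T]]. *)
Lemma holder_selections_bound (G : R -> set 'M[R]_(e, d)) g :
  holder_selections T alpha r G g -> 0 <= r /\ holder_bound alpha T r g.
Proof.
move=> [_ _ /holder_boundP-/(_ alpha0) gr]; split=> //.
have := gr 0 T (lexx _) (ltW T0) (lexx _); rewrite subr0.
move=> /(le_trans (enorm_ge0 _)); rewrite pmulr_lge0//.
exact: powR_gt0.
Qed.

Lemma locate_node (g : R -> 'M[R]_(e, d)) (s : seq R) t :
  dissection T s -> 0 <= t <= T ->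
  exists i, [/\ (i < size s)%N, node s i <= t <= node s i.+1 &
    interp g 0 s t = interp2 g (node s i) (node s i.+1) t].
Proof. by move=> [_ /eqP ls] tT; apply: interp_locate; rewrite ls. Qed.

Lemma interp_selection g n : holder_selections T alpha r F g ->
  holder_selections T alpha r (Fn n) (interp g 0 (D n)).
Proof.
move=> Sg; have [r0 gr] := holder_selections_bound _ _ Sg.
have [_ Fg _] := Sg.
have ir := interp_holder alpha T r g (D n) T0 alpha01 r0 (dissD n) gr.
split; first exact: (holder_measurable alpha T r).
  move=> t tT; have [i [si it ->]] := locate_node g _ _ (dissD n) tT.
  have [a0 bT ab _] := dissection_node _ _ _ (dissD n) si.
  rewrite (FnE _ _ _ si it) /interp2.
  move: (node _ i) (node _ i.+1) a0 bT ab it => a b a0 bT ab it.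
  exists (((b - t) / (b - a)) *: g a).
    by exists (g a) => //; apply: Fg; lra.
  exists (((t - a) / (b - a)) *: g b) => //.
  by exists (g b) => //; apply: Fg; lra.
exact/holder_boundP.
Qed.

(** The rank beyond which this holds is the same for all [b], because the sewing constant depends on
    [r] and not on the selection. *)
Lemma young_image_lower eps : 0 < eps -> \forall n \near \oo,
  forall b, young_image T alpha r F w b ->
    exists2 a, young_image T alpha r (Fn n) w a & enorm (a - b) <= eps.
Proof.
move=> eps0; have e2 := divr_gt0 eps0 (ltr0n R 2).
(* For negative [r] there are no selections and the claim is vacuous. *)
have [r0|r0] := leP 0 r; last first.
  apply: filterE => n b [g /holder_selections_bound[+ _] _].
  by rewrite leNgt r0.
near=> n.
have small : C * mesh (D n) `^ (theta - 1) < eps / 2.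
  by near: n; apply: mesh_powR_small => //; exact: ltW.
move=> _ [g Sg <-]; have Sn := interp_selection _ n Sg.
have [_ gr] := holder_selections_bound _ _ Sg.
have [_ nr] := holder_selections_bound _ _ Sn.
exists (young_integral T (interp g 0 (D n)) w); first by exists (interp g 0 (D n)).
apply: le_trans (enorm_triangle (riemann_sum g w (D n)) _ _) _.
have bound (h : R -> 'M[R]_(e, d)) : holder_bound alpha T r h ->
    enorm (riemann_sum h w (D n) - young_integral T h w)
      <= C * mesh (D n) `^ (theta - 1).
  move=> hr; apply: (young_integral_bound alpha beta T r q) meshD _ _ => //.
  exact: ltW.
have -> : eps = eps / 2 + eps / 2 by field.
apply: lerD; last by rewrite (le_trans (bound _ gr))// ltW.
by rewrite enormC -(interp_riemann_sum _ _ T)// (le_trans (bound _ nr))// ltW.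
Unshelve. all: by end_near. Qed.

Lemma Fn_close n t x : 0 <= t <= T -> Fn n t x ->
  exists2 y, F t y & enorm (x - y) <= c * mesh (D n) `^ alpha.
Proof.
(* The zero function serves only to obtain the index of the piece that contains [t]. *)
move=> tT; have [i [si it _]] := locate_node 0 _ _ (dissD n) tT.
have [a0 bT ab bad] := dissection_node _ _ _ (dissD n) si.
rewrite (FnE _ _ _ si it).
exact: (interp_multifun_close alpha T c _ F (ltW alpha0) c0 cF Fc).
Qed.

(** The values of a selection of [Fn n] are merely close to [F], so an actual selection of [F] is
    obtained from compactness, by contradiction. *)
Lemma young_image_upper eps : 0 < eps -> \forall n \near \oo,
  forall a, young_image T alpha r (Fn n) w a ->
    exists2 b, young_image T alpha r F w b & enorm (a - b) <= eps.
Proof.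
move=> eps0; pose bad n g := holder_selections T alpha r (Fn n) g /\
  forall b, young_image T alpha r F w b -> eps < enorm (young_integral T g w - b).
pose B := [set n | exists g, bad n g].
have [BN|BN] := pselect (\forall n \near \oo, ~ B n).
  apply: filterS BN => n Bn _ [g Sg <-]; apply: contrapT => nex; apply: Bn.
  exists g; split=> // b Jb; rewrite ltNge; apply/negP => le_eps.
  by apply: nex; exists b.
(* As [B] is met at arbitrarily large indices, the trace of [\oo] on it is proper. An ultrafilter
   [U] finer than this trace contains [B] and every eventual property. *)
exfalso; have WB : ProperFilter (within B \oo).
  by apply: Build_ProperFilter => //; exact: within_filter.
have [U [UU BU]] := ultraFilterLemma WB.
have U_oo (P : set nat) : (\forall n \near \oo, P n) -> U P.
  by move=> oP; apply: BU; apply: filterS oP.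
have UB : U B by apply: BU; exact: withinT.
have /choice[g Hg] : forall n, exists h, B n -> bad n h.
  by move=> n; have [[h ?]|?] := pselect (B n); [exists h|exists (fun=> 0)].
have [N /Hg[SN _]] := filter_ex UB.
have [r0 _] := holder_selections_bound _ _ SN.
have e3 := divr_gt0 eps0 (ltr0n R 3).
have [f Hf] : exists f, forall t, 0 <= t <= T -> F t (f t) /\
    forall eps, 0 < eps -> \forall n \near U, enorm (g n t - f t) < eps.
  apply: (@ultra_selection _ _ _ _ T U _ F g (fun n => c * mesh (D n) `^ alpha)) => //.
    move=> eta eta0; apply: U_oo.
    have [dl dl0 H] := powR_small c alpha eta c0 alpha0 eta0.
    near=> n; apply: H; first exact: mesh_ge0.
    by near: n; exact: mesh_lt.
  apply: filterS UB => n /Hg[[_ Fg _] _] t tT; exact/Fn_close/Fg.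
(* For fixed [u] and [v] the bound on [g n] passes to the pointwise limit with the same constant
   [r]. *)
have fr : holder_bound alpha T r f.
  move=> u v u0 uv vT; apply/ler_addgt0Pr => eta eta0.
  have eta2 := divr_gt0 eta0 (ltr0n R 2).
  near U => n.
  have /Hg[/holder_selections_bound[_ gr] _] : B n by near: n; exact: UB.
  have h1 : enorm (g n u - f u) < eta / 2.
    by near: n; have [|_] := Hf u; [lra|apply].
  have h2 : enorm (g n v - f v) < eta / 2.
    by near: n; have [|_] := Hf v; [lra|apply].
  have h3 := gr u v u0 uv vT.
  have h4 := enorm_triangle (g n v) (f v) (f u).
  have h5 := enorm_triangle (g n u) (g n v) (f u).
  by move: h4; rewrite (enormC (f v) (g n v)); lra.
have Sf : holder_selections T alpha r F f.
  split; first exact: (holder_measurable alpha T r).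
    by move=> t /Hf[].
  exact/holder_boundP.
have bound s (h : R -> 'M[R]_(e, d)) : dissection T s -> holder_bound alpha T r h ->
    enorm (riemann_sum h w s - young_integral T h w) <= C * mesh s `^ (theta - 1).
  move=> ds hr; apply: (young_integral_bound alpha beta T r q) meshD _ _ => //.
  exact: ltW.
(* The dissection [D m] is fixed before [n]: its rate is valid for [f] and for all [g n], and on it
   the Riemann sums of [g n] converge to that of [f]. *)
have [m Hm] : exists m, C * mesh (D m) `^ (theta - 1) < eps / 3.
  near \oo => m; exists m; near: m.
  by apply: mesh_powR_small => //; exact: ltW.
near U => n.
have /Hg[Sg gfar] : B n by near: n; exact: UB.
have [_ gr] := holder_selections_bound _ _ Sg.
have h1 : enorm (riemann_sum (g n) w (D m) - riemann_sum f w (D m)) < eps / 3.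
  rewrite !riemann_sumE; near: n; have [pD /eqP lD] := dissD m.
  apply: (rsum_pointwise_cvg T) => //; last by rewrite lD.
  by move=> t /Hf[].
have := gfar _ (ex_intro2 _ _ f Sf erefl); apply/negP; rewrite -leNgt.
have -> : eps = eps / 3 + (eps / 3 + eps / 3) by field.
apply: le_trans (enorm_triangle (riemann_sum (g n) w (D m)) _ _) _.
apply: lerD; first by rewrite enormC (le_trans (bound _ _ (dissD m) gr))// ltW.
apply: le_trans (enorm_triangle (riemann_sum f w (D m)) _ _) _.
by apply: lerD; [exact: ltW|rewrite (le_trans (bound _ _ (dissD m) fr))// ltW].
Unshelve. all: by end_near. Qed.

End convergence.
Theorem proposition3p14 (R : realType) (T : R) (d e : nat) (alpha beta r : R)
    (F : R -> set 'M[R]_(e, d)) (w : R -> 'cV[R]_d)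
    (D : nat -> seq R) (Fn : nat -> R -> set 'M[R]_(e, d)) :
  0 < T -> (0 < d)%N -> (0 < e)%N ->
  0 < alpha <= 1 -> 0 < beta <= 1 -> 1 < alpha + beta ->
  holder_multifun alpha T F ->
  holder_fun beta T w ->
  (r_min alpha T F <= r%:E)%E ->
  (forall n, dissection T (D n)) ->
  mesh (D n) @[n --> \oo] --> (0 : R) ->
  (forall n i t, (i < size (D n))%N -> node (D n) i <= t <= node (D n) i.+1 ->
    let h := node (D n) i.+1 - node (D n) i in
    Fn n t = minkowski_add
      (minkowski_scale ((node (D n) i.+1 - t) / h) (F (node (D n) i)))
      (minkowski_scale ((t - node (D n) i) / h) (F (node (D n) i.+1)))) ->
  hausdorff (young_image T alpha r (Fn n) w) (young_image T alpha r F w)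
    @[n --> \oo] --> 0%E.

Proof.
move=> T0 _ _ a01 b01 ab1 hF hw _ dissD meshD FnE.
have [b0 _] := andP b01.
have [q q0 /(holder_boundP _ _ _ _ b0) wq] := holder_norm_fin _ _ _ _ hw.
have [c c0 Fc] := holder_multifun_bound _ _ _ hF.
have [cF _] := hF.
apply: ereal_cvg0 => [n|eps eps0]; first exact: hausdorff_ge0.
near=> n; apply: hausdorff_le; first exact: ltW.
  near: n; exact: (young_image_upper T alpha beta r q c F w D Fn T0 a01 (ltW b0)).
near: n; exact: (young_image_lower T alpha beta r q F w D Fn T0 a01 (ltW b0)).
Unshelve. all: by end_near. Qed.
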